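(* Let $\hat H=\sum_{\bm R\in\Lambda}\hat H_{\bm R}$ be a free-fermion Hamiltonian, not necessarily $\mathrm{U}(1)$-symmetric, with local terms in Bogoliubov–de Gennes form $\hat H_{\bm R}=\hat\Psi^\dagger h_{\bm R}\hat\Psi+C_{\bm R}$, where each $h_{\bm R}$ is Hermitian and satisfies the particle-hole symmetry $U_{\mathcal P}h_{\bm R}^{\top}U_{\mathcal P}^\dagger=-h_{\bm R}$. For each $\bm R$ let $\bm\psi_{\bm R\alpha}$ ($\alpha=1,\dots,A_{\bm R}$) be an orthonormal family of eigenvectors of $h_{\bm R}$ belonging to (all of) its positive eigenvalues, counted with multiplicity, and put $\hat\psi_{\bm R\alpha}=\bm\psi_{\bm R\alpha}^\dagger\hat\Psi$. Then $\hat H=\sum_{\bm R}\hat H_{\bm R}$ is frustration-free if and only if $$\{\hat\psi_{\bm R\alpha},\hat\psi_{\bm R'\alpha'}\}=0\qquad\text{for all }\bm R,\bm R'\in\Lambda,\ \alpha\in\{1,\dots,A_{\bm R}\},\ \alpha'\in\{1,\dots,A_{\bm R'}\}.$$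
   Context: The system has finitely many fermionic modes, collected in a column vector $\hat{\bm c}=(\hat c_1,\dots,\hat c_M)^\top$ with $\{\hat c_i,\hat c_j^\dagger\}=\delta_{ij}$, $\{\hat c_i,\hat c_j\}=0$ on the fermionic Fock space; the modes are attached to unit cells in a finite set $\Lambda$. The Nambu spinor is $\hat\Psi=(\hat c_1,\dots,\hat c_M,\hat c_1^\dagger,\dots,\hat c_M^\dagger)^\top$, $\hat\Psi^\dagger=(\hat c_1^\dagger,\dots,\hat c_M^\dagger,\hat c_1,\dots,\hat c_M)$, and $U_{\mathcal P}=\begin{pmatrix}0&\mathbb 1_M\\ \mathbb 1_M&0\end{pmatrix}$. Each $h_{\bm R}$ is a $2M\times2M$ Hermitian matrix whose entries vanish outside the modes within a fixed finite distance of $\bm R$; $C_{\bm R}\in\mathbb R$. Any Hermitian quadratic form in Majorana operators can be written in this form. $\{A,B\}=AB+BA$. Frustration-free: writing $E_{\bm R}$ for the smallest eigenvalue of $\hat H_{\bm R}$ on Fock space, $\hat H=\sum_{\bm R}\hat H_{\bm R}$ is frustration-free if there is a nonzero Fock-space vector $|\Phi\rangle$ with $\hat H_{\bm R}|\Phi\rangle=E_{\bm R}|\Phi\rangle$ for all $\bm R\in\Lambda$ simultaneously. *)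

(* Defs.v *)
From HB Require Import structures.
From mathcomp Require Import all_boot all_order all_algebra.
From mathcomp Require Import ring reals complex.
Set Implicit Arguments.
Unset Strict Implicit.
Unset Printing Implicit Defensive.
Import Order.TTheory GRing.Theory Num.Theory.
Local Open Scope ring_scope.
Local Open Scope complex_scope.
Local Open Scope sesquilinear_scope.

(* The Fock space of M fermionic modes, in the occupation-number basis: Phi S
   is the amplitude of the basis state whose occupied modes are those in S,
   namely c_{s1}^dagger ... c_{sk}^dagger |0> for S = {s1 < ... < sk}. *)
Definition fock (R : realType) (M : nat) := {ffun {set 'I_M} -> R[i]^o}.
HB.instance Definition _ (R : realType) (M : nat) :=
  Vector.copy (fock R M) {ffun {set 'I_M} -> R[i]^o}.

Definition inner (R : realType) (M : nat) (Phi Xi : fock R M) : R[i] :=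
  \sum_(S : {set 'I_M}) (Phi S)^* * Xi S.

Definition jw_sign (R : realType) (M : nat) (i : 'I_M) (S : {set 'I_M}) : R[i] :=
  (-1) ^+ #|[set j in S | (j < i)%N]|.

Definition annihilate (R : realType) (M : nat) (i : 'I_M) (Phi : fock R M) :
    fock R M :=
  [ffun S : {set 'I_M} => if i \in S then 0 else jw_sign R i S * Phi (i |: S)].

Definition create (R : realType) (M : nat) (i : 'I_M) (Phi : fock R M) :
    fock R M :=
  [ffun S : {set 'I_M} => if i \in S then jw_sign R i S * Phi (S :\ i) else 0].

Lemma annihilate_is_linear (R : realType) (M : nat) (i : 'I_M) :
  linear (@annihilate R M i).
Proof.
move=> a u v; apply/ffunP=> S; rewrite !ffunE; case: ifP => _.
  by rewrite scaler0 addr0.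
by rewrite mulrDr /GRing.scale /= mulrCA.
Qed.
HB.instance Definition _ (R : realType) (M : nat) (i : 'I_M) :=
  GRing.isLinear.Build R[i] (fock R M) (fock R M) *:%R (@annihilate R M i)
    (@annihilate_is_linear R M i).

Lemma create_is_linear (R : realType) (M : nat) (i : 'I_M) :
  linear (@create R M i).
Proof.
move=> a u v; apply/ffunP=> S; rewrite !ffunE; case: ifP => _.
  by rewrite mulrDr /GRing.scale /= mulrCA.
by rewrite scaler0 addr0.
Qed.
HB.instance Definition _ (R : realType) (M : nat) (i : 'I_M) :=
  GRing.isLinear.Build R[i] (fock R M) (fock R M) *:%R (@create R M i)
    (@create_is_linear R M i).

Definition c_op (R : realType) (M : nat) (i : 'I_M) : 'End(fock R M) :=
  linfun (@annihilate R M i).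

Definition cdag_op (R : realType) (M : nat) (i : 'I_M) : 'End(fock R M) :=
  linfun (@create R M i).

Definition anticomm (R : realType) (M : nat) (X Y : 'End(fock R M)) :
    'End(fock R M) :=
  (X \o Y)%VF + (Y \o X)%VF.

Lemma jw_signU1 (R : realType) (M : nat) (i j : 'I_M) (S : {set 'I_M}) :
  j \notin S -> jw_sign R i (j |: S) = (-1) ^+ (j < i)%N * jw_sign R i S.
Proof.
move=> jS; rewrite /jw_sign -exprD; congr (_ ^+ _).
case: (boolP (j < i)%N) => ji.
  have -> : [set k in j |: S | (k < i)%N] = j |: [set k in S | (k < i)%N].
    apply/setP=> k; rewrite !inE; case: (eqVneq k j) => [->|_] //=.
  by rewrite cardsU1 inE (negPf jS).
congr #|pred_of_set _|; apply/setP=> k; rewrite !inE.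
by case: (eqVneq k j) => [->|_] //=; rewrite (negPf ji) andbF.
Qed.

Lemma jw_signD1 (R : realType) (M : nat) (i j : 'I_M) (S : {set 'I_M}) :
  j \in S -> jw_sign R i (S :\ j) = (-1) ^+ (j < i)%N * jw_sign R i S.
Proof.
move=> jS; rewrite -{2}(setD1K jS) jw_signU1 ?setD11 //.
by rewrite mulrA -signr_addb addbb mul1r.
Qed.

Lemma jw_sign_sqr (R : realType) (M : nat) (i : 'I_M) (S : {set 'I_M}) :
  jw_sign R i S * jw_sign R i S = 1.
Proof. by rewrite /jw_sign -expr2 sqrr_sign. Qed.

Lemma ltn_sign (R : realType) (M : nat) (i j : 'I_M) :
  i != j -> (-1) ^+ (i < j)%N = - (-1) ^+ (j < i)%N :> R[i].
Proof.
by rewrite -(inj_eq val_inj) /=; case: ltngtP => //= _ _;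
  rewrite ?expr1 ?expr0 ?opprK.
Qed.

Lemma cdag_op_adjoint (R : realType) (M : nat) (i : 'I_M) (Phi Xi : fock R M) :
  inner (cdag_op R i Phi) Xi = inner Phi (c_op R i Xi).
Proof.
rewrite /inner /c_op /cdag_op.
under eq_bigr do rewrite lfunE /= ffunE.
under [RHS]eq_bigr do rewrite lfunE /= ffunE.
rewrite (bigID (fun S : {set 'I_M} => i \in S)) /= [X in _ + X]big1 ?addr0; last first.
  by move=> S /negPf->; rewrite rmorph0 mul0r.
rewrite [RHS](bigID (fun S : {set 'I_M} => i \notin S)) /=.
rewrite [X in _ = _ + X]big1 ?addr0; last first.
  by move=> S; rewrite negbK => ->; rewrite mulr0.
rewrite (reindex_onto (fun S => i |: S) (fun S => S :\ i)) /=; last first.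
  by move=> S; exact: setD1K.
apply: eq_big => [S|S /andP[_ /eqP iS]].
  rewrite setU11 /=; apply/eqP/idP => [<-|iS]; first by rewrite setD11.
  by rewrite setU1K.
have niS : i \notin S by rewrite -iS setD11.
rewrite setU11 (negPf niS) iS jw_signU1 // ltnn expr0 mul1r.
by rewrite rmorphM /jw_sign rmorphXn rmorphN1 mulrCA mulrA.
Qed.

Lemma anticomm_c_c (R : realType) (M : nat) (i j : 'I_M) :
  anticomm (c_op R i) (c_op R j) = 0.
Proof.
apply/lfunP=> Phi; rewrite add_lfunE !comp_lfunE zero_lfunE !lfunE /=.
apply/ffunP=> S; rewrite !ffunE !inE.
case: (eqVneq i j) => [->|ij].
  by rewrite ?eqxx; case: ifP => _; rewrite ?mulr0 addr0.
rewrite /=.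
case: (boolP (i \in S)) => iS; case: (boolP (j \in S)) => jS;
  rewrite ?(mulr0, addr0) //.
rewrite !jw_signU1 // (ltn_sign R ij) setUCA.
ring.
Qed.

Lemma anticomm_cdag_cdag (R : realType) (M : nat) (i j : 'I_M) :
  anticomm (cdag_op R i) (cdag_op R j) = 0.
Proof.
apply/lfunP=> Phi; rewrite add_lfunE !comp_lfunE zero_lfunE !lfunE /=.
apply/ffunP=> S; rewrite !ffunE !inE.
case: (eqVneq i j) => [->|ij].
  by rewrite ?eqxx; case: ifP => _; rewrite ?mulr0 addr0.
rewrite /=.
case: (boolP (i \in S)) => iS; case: (boolP (j \in S)) => jS;
  rewrite ?(mulr0, addr0) //.
rewrite !jw_signD1 // (ltn_sign R ij) !setDDl (setUC [set j]).
ring.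
Qed.

Lemma anticomm_c_cdag (R : realType) (M : nat) (i j : 'I_M) :
  anticomm (c_op R i) (cdag_op R j) = (i == j)%:R *: \1%VF.
Proof.
apply/lfunP=> Phi; rewrite add_lfunE !comp_lfunE scale_lfunE id_lfunE !lfunE /=.
apply/ffunP=> S; rewrite !ffunE !inE.
case: (eqVneq i j) => [<-{j}|ij].
  rewrite ?eqxx /= scale1r; case: (boolP (i \in S)) => iS.
    by rewrite jw_signD1 // ltnn mul1r add0r setD1K // mulrA jw_sign_sqr mul1r.
  by rewrite jw_signU1 // ltnn mul1r addr0 setU1K // mulrA jw_sign_sqr mul1r.
rewrite /= scale0r.
case: (boolP (i \in S)) => iS; case: (boolP (j \in S)) => jS;
  rewrite ?(mulr0, addr0, add0r) //.
rewrite jw_signU1 // jw_signD1 // (ltn_sign R ij).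
have -> : (i |: S) :\ j = i |: (S :\ j).
  by apply/setP=> k; rewrite !inE; case: (eqVneq k i) => [->|_] //=; rewrite ij.
ring.
Qed.

(* The first M components of the Nambu spinor are the c_i, the last M the
   c_i^dagger. *)
Definition nambu (R : realType) (M : nat) (a : 'I_(M + M)) : 'End(fock R M) :=
  match split a with inl i => c_op R i | inr i => cdag_op R i end.

Definition nambu_dag (R : realType) (M : nat) (a : 'I_(M + M)) :
    'End(fock R M) :=
  match split a with inl i => cdag_op R i | inr i => c_op R i end.

Definition nambu_mode (M : nat) (a : 'I_(M + M)) : 'I_M :=
  match split a with inl i => i | inr i => i end.

Definition bdg (R : realType) (M : nat) (h : 'M[R[i]]_(M + M)) (C : R) :
    'End(fock R M) :=
  \sum_a \sum_b h a b *: (nambu_dag R a \o nambu R b)%VF + C%:C *: \1%VF.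

Definition U_P (R : realType) (M : nat) : 'M[R[i]]_(M + M) :=
  block_mx 0 1%:M 1%:M 0.

Definition particle_hole (R : realType) (M : nat) (h : 'M[R[i]]_(M + M)) :=
  U_P R M *m h^T *m (U_P R M)^t* = - h.

Definition qp_op (R : realType) (M : nat) (psi : 'cV[R[i]]_(M + M)) :
    'End(fock R M) :=
  \sum_a (psi a 0)^* *: nambu R a.

(* Orthonormal eigenvectors (as columns) for all the positive eigenvalues of h,
   each occurring as often as its multiplicity.  The library's eigenspace
   consists of row vectors, whence the transpose; since h is Hermitian its
   eigenvalues are real, so that e ranges over R. *)
Definition positive_eigenframe (R : realType) (n A : nat) (h : 'M[R[i]]_n)
    (psi : 'I_A -> 'cV[R[i]]_n) : Prop :=
  exists eps : 'I_A -> R,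
    [/\ forall al be, (psi al)^t* *m psi be = (al == be)%:R%:M,
        forall al, 0 < eps al /\ h *m psi al = (eps al)%:C *: psi al
      & forall e : R, 0 < e ->
          #|[set al | eps al == e]| = \rank (eigenspace h^T e%:C)].

Definition smallest_eigenvalue (R : realType) (M : nat) (H : 'End(fock R M))
    (E : R) : Prop :=
  passmx.leigenvalue H E%:C /\ forall e : R[i], passmx.leigenvalue H e -> E%:C <= e.

Definition frustration_free (R : realType) (M : nat) (Lambda : finType)
    (H : Lambda -> 'End(fock R M)) : Prop :=
  exists Phi : fock R M, Phi != 0 /\
    forall r : Lambda, exists E : R,
      smallest_eigenvalue (H r) E /\ H r Phi = E%:C *: Phi.

Definition is_metric (R : realType) (T : Type) (dist : T -> T -> R) : Prop :=
  [/\ forall x y, 0 <= dist x y,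
      forall x y, dist x y = 0 <-> x = y,
      forall x y, dist x y = dist y x
    & forall x y z, dist x z <= dist x y + dist y z].

(* cell i is the unit cell to which mode i is attached. *)
Definition supported_near (R : realType) (M : nat) (Lambda : finType)
    (cell : 'I_M -> Lambda) (dist : Lambda -> Lambda -> R) (range : R)
    (r : Lambda) (h : 'M[R[i]]_(M + M)) : Prop :=
  forall a b, h a b != 0 ->
    dist (cell (nambu_mode a)) r <= range /\
    dist (cell (nambu_mode b)) r <= range.

(* Main.v *)
(** Write [phi = U_P (conj psi)] for the particle-hole partner of [psi], so that
    [qp_op phi] is the adjoint of [qp_op psi].  The spectral theorem gives
    [h = \sum eps (psi psi^H - phi phi^H)]: the difference of the two sides kills
    every [psi] and [phi], so a nonzero eigenvalue of it, up to particle-hole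
    conjugation, would be a positive eigenvalue of [h] with an eigenvector
    orthogonal to the frame.  The canonical anticommutation relations turn this
    into [H_r = E_r + \sum 2 eps (qp_op psi)^H (qp_op psi)], where the [qp_op psi]
    of one term anticommute; hence [E_r] is the smallest eigenvalue and its
    eigenspace is the common kernel of these operators.  So the system is
    frustration-free iff all the [qp_op psi] have a common vacuum.  Their
    anticommutators are scalars, which must vanish if there is one; conversely
    finitely many anticommuting operators of square zero have a common vacuum. *)

Require Import Defs.
From mathcomp Require Import all_boot all_order all_algebra.
From mathcomp Require Import reals complex.
Import Order.TTheory GRing.Theory Num.Theory.
Local Open Scope ring_scope.
Local Open Scope complex_scope.
Local Open Scope sesquilinear_scope.

(** * Eigenvalues and eigenvectors of Hermitian matrices *)

Section HermitianMatrices.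
Set Implicit Arguments.
Unset Strict Implicit.
Context {C : numClosedFieldType}.

Lemma ctmx_mul m n p (A : 'M[C]_(m, n)) (B : 'M[C]_(n, p)) :
  (A *m B)^t* = B^t* *m A^t*.
Proof. by rewrite trmx_mul map_mxM. Qed.

Lemma ctmxZ m n (a : C) (A : 'M[C]_(m, n)) : (a *: A)^t* = a^* *: A^t*.
Proof. by rewrite linearZ /= map_mxZ. Qed.

Lemma hermsymmxE n (H : 'M[C]_n) : (H \is hermsymmx) = (H^t* == H).
Proof. by rewrite is_hermitianmxE expr0 scale1r eq_sym. Qed.

Lemma ctmx_mul_eq0 n (v : 'cV[C]_n) : v^t* *m v = 0 -> v = 0.
Proof.
move=> /matrixP/(_ 0 0); rewrite !mxE => /eqP.
have nneg (j : 'I_n) : true -> 0 <= (v^t*) 0 j * v j 0.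
  by move=> _; rewrite !mxE mulrC mul_conjC_ge0.
rewrite psumr_eq0 // => /allP v0; apply/matrixP => j k; rewrite ord1 mxE.
by have := v0 j (mem_index_enum j); rewrite !mxE mulrC mul_conjC_eq0 => /eqP.
Qed.

Lemma hermsymmx_real n (H : 'M[C]_n) (e : C) (v : 'cV[C]_n) :
  H \is hermsymmx -> v != 0 -> H *m v = e *: v -> e \is Num.real.
Proof.
rewrite hermsymmxE => /eqP Hh v0 Hv.
have : v^t* *m H *m v = (e^* *: v^t*) *m v by rewrite -ctmxZ -Hv ctmx_mul Hh.
rewrite -mulmxA Hv -scalemxAl -scalemxAr => /eqP.
rewrite -subr_eq0 -scalerBl scaler_eq0 => /orP[|/eqP/ctmx_mul_eq0 /eqP]; last first.
  by rewrite (negPf v0).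
by rewrite subr_eq0 CrealE eq_sym.
Qed.

Lemma hermsymmx_orthogonal n (H : 'M[C]_n) (a b : C) (u v : 'cV[C]_n) :
  H \is hermsymmx -> a \is Num.real -> a != b ->
  H *m u = a *: u -> H *m v = b *: v -> u^t* *m v = 0.
Proof.
rewrite hermsymmxE => /eqP Hh /CrealP ar ab Hu Hv.
have : u^t* *m H *m v = (a *: u^t*) *m v.
  by rewrite -{1}ar -ctmxZ -Hu ctmx_mul Hh.
rewrite -mulmxA Hv -scalemxAl -scalemxAr => /eqP.
by rewrite -subr_eq0 -scalerBl scaler_eq0 subr_eq0 eq_sym (negPf ab) => /eqP.
Qed.

(** In the spectral decomposition with unitary [P], the columns of [invmx P] are nonzero
    eigenvectors for the entries of the diagonal part, so each of these entries must vanish. *)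
Lemma hermsymmx_eq0 n (H : 'M[C]_n) : H \is hermsymmx ->
  (forall e (v : 'cV[C]_n), e != 0 -> H *m v = e *: v -> v = 0) -> H = 0.
Proof.
move=> /hermitian_normalmx /orthomx_spectralP HE noev.
set P := spectralmx H in HE; set d := spectral_diag H in HE.
have Pu : P \in unitmx by exact: spectral_unit.
suff d0 : d = 0 by rewrite HE d0 linear0 mulmx0 mul0mx.
apply/rowP => i; rewrite [RHS]mxE; apply/eqP/negP => /negP di.
have /noev : d 0 i != 0 by [].
move=> /(_ (invmx P *m delta_mx i 0)) Hi.
have : invmx P *m delta_mx i (0 : 'I_1) = 0.
  apply: Hi; rewrite {1}HE -!mulmxA (mulmxA P) mulmxV // mul1mx mul_diag_mx scalemxAr.
  congr (_ *m _); apply/matrixP => j k; rewrite !mxE.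
  by case: (eqVneq j i) => [->|_] //; rewrite /= !mulr0.
move=> /(congr1 (mulmx P)); rewrite mulmxA mulmxV // mul1mx mulmx0.
by move=> /matrixP/(_ i 0); rewrite !mxE !eqxx => /eqP; rewrite oner_eq0.
Qed.

End HermitianMatrices.

(** * Particle-hole conjugation and the spectral decomposition of a BdG matrix *)

Section ParticleHole.
Set Implicit Arguments.
Unset Strict Implicit.
Context {R : realType}.

(** A dimension count: the frame vectors of eigenvalue [e] are orthonormal, hence free, and as many
    as the dimension of the eigenspace, so they span it. Then [v] is a combination of vectors
    orthogonal to [v]. *)
Lemma positive_eigenvector_eq0 n A (h : 'M[R[i]]_n) (psi : 'I_A -> 'cV[R[i]]_n)
    (eps : 'I_A -> R) (e : R) (v : 'cV[R[i]]_n) :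
  (forall al be, (psi al)^t* *m psi be = (al == be)%:R%:M) ->
  (forall al, h *m psi al = (eps al)%:C *: psi al) ->
  #|[set al | eps al == e]| = \rank (eigenspace h^T e%:C) ->
  h *m v = e%:C *: v -> (forall al, (psi al)^t* *m v = 0) -> v = 0.
Proof.
move=> orth eig rk hv vorth.
set S := [set al | eps al == e] in rk.
pose B := \matrix_(i < #|S|) (psi (enum_val i))^T.
(* Orthonormality makes the conjugate transpose of [B] a right inverse. *)
have Bfree : row_free B.
  apply/row_freeP; exists (map_mx Num.conj B^T).
  apply/matrixP => i j.
  transitivity (((psi (enum_val j))^t* *m psi (enum_val i)) 0 0).
    by rewrite !mxE; apply: eq_bigr => k _; rewrite !mxE mulrC.
  by rewrite orth !mxE /= mulr1n (inj_eq enum_val_inj) eq_sym.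
have BW : (B <= eigenspace h^T e%:C)%MS.
  apply/row_subP => i; rewrite rowK; apply/eigenspaceP.
  rewrite -trmx_mul eig linearZ /=.
  by have := enum_valP i; rewrite inE => /eqP->.
have WB : (eigenspace h^T e%:C <= B)%MS.
  by have [_] := mxrank_leqif_eq BW; rewrite -rk (eqP Bfree) eqxx => /esym/andP[].
have : (v^T <= B)%MS.
  apply: submx_trans WB; apply/eigenspaceP; by rewrite -trmx_mul hv linearZ.
case/submxP => x vx; apply: ctmx_mul_eq0.
have vE : v = B^T *m x^T by rewrite -trmx_mul -vx trmxK.
rewrite [X in _ *m X]vE mulmxA.
suff -> : v^t* *m B^T = 0 by rewrite mul0mx.
apply/matrixP => j k; rewrite ord1.
transitivity ((((psi (enum_val k))^t* *m v)^t*) 0 0); last first.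
  by rewrite vorth !mxE conjC0.
rewrite ctmx_mul trmxCK !mxE; apply: eq_bigr => l _; by rewrite !mxE.
Qed.

Definition ph_conj M (v : 'cV[R[i]]_(M + M)) : 'cV[R[i]]_(M + M) :=
  U_P R M *m map_mx Num.conj v.

Lemma U_P_real M : map_mx Num.conj (U_P R M) = U_P R M.
Proof. by rewrite /U_P map_block_mx map_mx0 map_mx1. Qed.

Lemma U_P_sym M : (U_P R M)^T = U_P R M.
Proof. by rewrite /U_P tr_block_mx trmx0 trmx1. Qed.

Lemma U_P_sqr M : U_P R M *m U_P R M = 1%:M.
Proof.
by rewrite /U_P mulmx_block !mulmx0 !mul0mx !mulmx1 !addr0 !add0r -scalar_mx_block.
Qed.

Lemma ph_conjK M : involutive (@ph_conj M).
Proof.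
move=> v; rewrite /ph_conj map_mxM /= U_P_real mulmxA U_P_sqr mul1mx.
by apply/matrixP => j k; rewrite !mxE conjCK.
Qed.

Lemma ph_conj0 M : @ph_conj M 0 = 0.
Proof. by rewrite /ph_conj map_mx0 mulmx0. Qed.

(** Antiunitarity of the conjugation: [U_P] is a real symmetric involution, so only the complex
    conjugation affects the scalar product. *)
Lemma ph_conj_dot M (u v : 'cV[R[i]]_(M + M)) :
  (ph_conj u)^t* *m ph_conj v = map_mx Num.conj (u^t* *m v).
Proof.
rewrite /ph_conj ctmx_mul U_P_sym U_P_real -mulmxA (mulmxA (U_P R M)) U_P_sqr.
by rewrite mul1mx map_mxM; congr (_ *m _); rewrite map_trmx.
Qed.

(** For Hermitian [h] the transpose is the entrywise conjugate, so particle-hole symmetry says that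
    [ph_conj] anticommutes with [h]; a real [e] passes unchanged through the conjugation. *)
Lemma ph_conj_eigen M (h : 'M[R[i]]_(M + M)) (e : R[i]) v :
  h \is hermsymmx -> particle_hole h -> e \is Num.real ->
  h *m v = e *: v -> h *m ph_conj v = (- e) *: ph_conj v.
Proof.
rewrite hermsymmxE => /eqP hh hp /CrealP er hv.
have hT : h^T = map_mx Num.conj h.
  by rewrite -{2}hh; apply/matrixP => j k; rewrite !mxE conjCK.
rewrite -[h in LHS]opprK -hp U_P_sym U_P_real /ph_conj hT mulNmx.
rewrite -!mulmxA (mulmxA (U_P R M) (U_P R M)) U_P_sqr mul1mx -map_mxM hv.
by rewrite map_mxZ -scalemxAr scaleNr; congr (- (_ *: _)).
Qed.

Lemma bdg_matrix_decomposition M A (h : 'M[R[i]]_(M + M))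
    (psi : 'I_A -> 'cV[R[i]]_(M + M)) (eps : 'I_A -> R) :
  h \is hermsymmx -> particle_hole h ->
  (forall al be, (psi al)^t* *m psi be = (al == be)%:R%:M) ->
  (forall al, 0 < eps al /\ h *m psi al = (eps al)%:C *: psi al) ->
  (forall e : R, 0 < e ->
     #|[set al | eps al == e]| = \rank (eigenspace h^T e%:C)) ->
  (forall al be, (psi al)^t* *m ph_conj (psi be) = 0) /\
  h = \sum_al (eps al)%:C *:
        (psi al *m (psi al)^t* - ph_conj (psi al) *m (ph_conj (psi al))^t*).
Proof.
move=> hh hp orth eig' rk.
have eps0 al : 0 < eps al by have [] := eig' al.
have eig al : h *m psi al = (eps al)%:C *: psi al by have [] := eig' al.
have epsr al : (eps al)%:C \is Num.real.
  by apply/ger0_real; rewrite lecR ltW.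
have phi_eig al : h *m ph_conj (psi al) = (- (eps al)%:C) *: ph_conj (psi al).
  exact: ph_conj_eigen.
have orth0 al be : (psi al)^t* *m ph_conj (psi be) = 0.
  (* The eigenvalues [eps al] and [- eps be] have opposite signs, hence differ. *)
  apply: (hermsymmx_orthogonal hh (epsr al) _ (eig al) (phi_eig be)).
  rewrite -subr_eq0 opprK -rmorphD /= -[0]/(0%:C) (inj_eq (@complexI R)).
  by rewrite gt_eqF // addr_gt0.
split=> //.
set S := \sum_al _.
have orth1 al be : (ph_conj (psi al))^t* *m psi be = 0.
  by rewrite -[psi be]ph_conjK ph_conj_dot orth0 map_mx0.
have orth2 al be : (ph_conj (psi al))^t* *m ph_conj (psi be) = (al == be)%:R%:M.
  by rewrite ph_conj_dot orth map_scalar_mx /= conjC_nat.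
have SZ (v : 'cV_(M + M)) : S *m v = \sum_al (eps al)%:C *:
    (psi al *m ((psi al)^t* *m v) - ph_conj (psi al) *m ((ph_conj (psi al))^t* *m v)).
  rewrite mulmx_suml; apply: eq_bigr => al _.
  by rewrite -scalemxAl mulmxBl !mulmxA.
have Spsi be : S *m psi be = (eps be)%:C *: psi be.
  rewrite SZ (bigD1 be) //= big1 ?addr0 => [|al albe].
    by rewrite orth orth1 eqxx mulmx0 subr0 mulmx1.
  by rewrite orth orth1 (negPf albe) raddf0 !mulmx0 subr0 scaler0.
have Sphi be : S *m ph_conj (psi be) = (- (eps be)%:C) *: ph_conj (psi be).
  rewrite SZ (bigD1 be) //= big1 ?addr0 => [|al albe].
    by rewrite orth0 orth2 eqxx mulmx0 sub0r mulmx1 scalerN scaleNr.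
  by rewrite orth0 orth2 (negPf albe) mulmx0 raddf0 !mulmx0 subr0 scaler0.
have Sh : S^t* = S.
  rewrite /S !raddf_sum /=; apply: eq_bigr => al _.
  rewrite ctmxZ (CrealP (epsr al)) linearB /= map_mxB !ctmx_mul !trmxCK.
  by [].
have dh : h - S \is hermsymmx.
  by move: hh; rewrite !hermsymmxE linearB /= map_mxB Sh => /eqP->.
apply/eqP; rewrite -subr_eq0; apply/eqP.
apply: (hermsymmx_eq0 dh) => e v e0 dv; apply/eqP/negP => /negP v0.
have er := hermsymmx_real dh v0 dv.
(* The frame vectors and their partners lie in the kernel of [h - S], hence are orthogonal to [v],
   whose eigenvalue [e] is nonzero. So [S] kills [v], and [v] is an eigenvector of [h] itself. *)
have pv al : (psi al)^t* *m v = 0.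
  apply: (hermsymmx_orthogonal dh (a := 0) (b := e)); rewrite ?rpred0 1?eq_sym //.
  by rewrite mulmxBl eig Spsi subrr scale0r.
have qv al : (ph_conj (psi al))^t* *m v = 0.
  apply: (hermsymmx_orthogonal dh (a := 0) (b := e)); rewrite ?rpred0 1?eq_sym //.
  by rewrite mulmxBl phi_eig Sphi subrr scale0r.
have hv : h *m v = e *: v.
  rewrite -dv mulmxBl SZ big1 ?subr0 // => al _.
  by rewrite pv qv !mulmx0 subr0 scaler0.
have pos (f : R[i]) (w : 'cV_(M + M)) : 0 < f -> h *m w = f *: w ->
    (forall al, (psi al)^t* *m w = 0) -> w = 0.
  (* Positivity in the order of [R[i]] forces a zero imaginary part, so the multiplicity hypothesis
     applies to the real part. *)
  case: f => a b; rewrite ltcE /= => /andP[/eqP-> a0] hw pw.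
  exact: (positive_eigenvector_eq0 orth eig (rk a a0) hw pw).
case/negP: v0; apply/eqP; have [e_gt0|] := real_ltP (real0 _) er.
  exact: pos hv pv.
(* For negative [e], the conjugate of [v] has the positive eigenvalue [- e] and is again orthogonal
   to the frame. *)
rewrite le_eqVlt (negPf e0) /= -oppr_gt0 => /pos H.
rewrite -[v]ph_conjK (H (ph_conj v)) ?ph_conj0 // => [|al].
  exact: ph_conj_eigen.
by rewrite -[psi al]ph_conjK ph_conj_dot qv map_mx0.
Qed.

End ParticleHole.

(** * Quasiparticle operators on Fock space *)

Section FockOperators.
Set Implicit Arguments.
Unset Strict Implicit.
Context {R : realType} {M : nat}.
Implicit Types (Phi Xi : fock R M) (u v : 'cV[R[i]]_(M + M)).

Lemma inner_conj Phi Xi : (inner Phi Xi)^*%R = inner Xi Phi.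
Proof.
rewrite /inner rmorph_sum; apply: eq_bigr => S _ /=.
by rewrite rmorphM mulrC; congr (_ * _); exact: conjCK.
Qed.

Lemma inner0r Phi : inner Phi 0 = 0.
Proof. by rewrite /inner big1 // => S _; rewrite ffunE mulr0. Qed.

Lemma innerDr Phi Xi Xi' : inner Phi (Xi + Xi') = inner Phi Xi + inner Phi Xi'.
Proof.
by rewrite /inner -big_split; apply: eq_bigr => S _ /=; rewrite ffunE mulrDr.
Qed.

Lemma innerZr (a : R[i]) Phi Xi : inner Phi (a *: Xi) = a * inner Phi Xi.
Proof.
by rewrite /inner mulr_sumr; apply: eq_bigr => S _ /=; rewrite ffunE mulrCA.
Qed.

Lemma inner_sumr I (r : seq I) (P : pred I) Phi (F : I -> fock R M) :
  inner Phi (\sum_(k <- r | P k) F k) = \sum_(k <- r | P k) inner Phi (F k).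
Proof. exact: (big_morph _ (innerDr Phi) (inner0r Phi)). Qed.

Lemma inner_ge0 Phi : 0 <= inner Phi Phi.
Proof. by apply: sumr_ge0 => S _; rewrite mulrC mul_conjC_ge0. Qed.

Lemma inner_eq0 Phi : inner Phi Phi = 0 -> Phi = 0.
Proof.
move=> /eqP; rewrite psumr_eq0 => [/allP P0|S _]; last first.
  by rewrite mulrC mul_conjC_ge0.
apply/ffunP => S; have := P0 S (mem_index_enum S).
by rewrite mulrC mul_conjC_eq0 ffunE => /eqP.
Qed.

Lemma inner_gt0 Phi : Phi != 0 -> 0 < inner Phi Phi.
Proof.
move=> P0; rewrite lt_def inner_ge0 andbT; apply: contra P0 => /eqP P0.
by rewrite (inner_eq0 P0).
Qed.

(** The adjoint of [qp_op v] for [inner]. *)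
Definition qp_dag v : 'End(fock R M) := \sum_a v a 0 *: nambu_dag R a.

Lemma qp_opE v Phi : qp_op v Phi = \sum_a (v a 0)^*%R *: nambu R a Phi.
Proof. by rewrite sum_lfunE; apply: eq_bigr => a _; rewrite scale_lfunE. Qed.

Lemma qp_dagE v Phi : qp_dag v Phi = \sum_a v a 0 *: nambu_dag R a Phi.
Proof. by rewrite sum_lfunE; apply: eq_bigr => a _; rewrite scale_lfunE. Qed.

Lemma nambu_adjoint a Phi Xi :
  inner Phi (nambu_dag R a Xi) = inner (nambu R a Phi) Xi.
Proof.
rewrite /nambu_dag /nambu; case: (split a) => i; last by rewrite cdag_op_adjoint.
by rewrite -inner_conj cdag_op_adjoint inner_conj.
Qed.

Lemma qp_adjoint v Phi Xi : inner Phi (qp_dag v Xi) = inner (qp_op v Phi) Xi.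
Proof.
rewrite -[RHS]inner_conj qp_opE qp_dagE !inner_sumr rmorph_sum /=.
by apply: eq_bigr => a _; rewrite !innerZr rmorphM /= conjCK inner_conj nambu_adjoint.
Qed.

Lemma anticommC (X Y : 'End(fock R M)) : anticomm X Y = anticomm Y X.
Proof. by rewrite /anticomm addrC. Qed.

Lemma anticomm_nambu a b :
  anticomm (nambu R a) (nambu_dag R b) = (a == b)%:R *: (\1%VF : 'End(fock R M)).
Proof.
rewrite /nambu /nambu_dag -[a]splitK -[b]splitK.
case: (split a) => i; case: (split b) => j; rewrite !unsplitK /=.
- by rewrite anticomm_c_cdag eq_lshift.
- by rewrite anticomm_c_c eq_lrshift scale0r.
- by rewrite anticomm_cdag_cdag eq_rlshift scale0r.
- by rewrite anticommC anticomm_c_cdag eq_rshift eq_sym.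
Qed.

Lemma anticomm_qp_dag u v :
  anticomm (qp_op u) (qp_dag v) = (u^t* *m v) 0 0 *: (\1%VF : 'End(fock R M)).
Proof.
transitivity (\sum_a \sum_b ((u a 0)^*%R * v b 0) *:
    anticomm (nambu R a) (nambu_dag R b)).
  apply/lfunP => Phi.
  rewrite /anticomm add_lfunE !comp_lfunE qp_opE (qp_dagE v (qp_op u Phi)).
  rewrite [RHS]sum_lfunE.
  under [RHS]eq_bigr do rewrite sum_lfunE.
  under [RHS]eq_bigr do under eq_bigr do
    rewrite scale_lfunE add_lfunE !comp_lfunE scalerDr.
  under [RHS]eq_bigr do rewrite big_split /=.
  rewrite big_split /=; congr (_ + _).
    apply: eq_bigr => a _; rewrite qp_dagE linear_sum scaler_sumr /=.
    by apply: eq_bigr => b _; rewrite linearZ scalerA.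
  rewrite exchange_big; apply: eq_bigr => b _ /=.
  rewrite qp_opE linear_sum scaler_sumr /=.
  by apply: eq_bigr => a _; rewrite linearZ scalerA mulrC.
rewrite mxE scaler_suml; apply: eq_bigr => a _.
rewrite (bigD1 a) //= big1 ?addr0 => [|b ba].
  by rewrite anticomm_nambu eqxx scale1r !mxE.
by rewrite anticomm_nambu eq_sym (negPf ba) scale0r scaler0.
Qed.

(** [U_P] swaps the two halves of the coefficient vector, and this exchanges creation and
    annihilation operators. *)
Lemma qp_dag_ph_conj v : qp_dag (ph_conj v) = qp_op v.
Proof.
rewrite /qp_dag /qp_op /ph_conj -[v]vsubmxK map_col_mx mul_block_col.
rewrite !mul0mx !mul1mx add0r addr0 !big_split_ord /= addrC; congr (_ + _).
  apply: eq_bigr => i _; rewrite !(col_mxEu, col_mxEd) !mxE.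
  by rewrite /nambu /nambu_dag -[lshift _ i]/(unsplit (inl i))
     -[rshift _ i]/(unsplit (inr i)) !unsplitK.
apply: eq_bigr => i _; rewrite !(col_mxEu, col_mxEd) !mxE.
by rewrite /nambu /nambu_dag -[lshift _ i]/(unsplit (inl i))
   -[rshift _ i]/(unsplit (inr i)) !unsplitK.
Qed.

Lemma qp_op_ph_conj v : qp_op (ph_conj v) = qp_dag v.
Proof. by rewrite -qp_dag_ph_conj ph_conjK. Qed.

Lemma anticomm_qp u v :
  anticomm (qp_op u) (qp_op v) =
  (u^t* *m ph_conj v) 0 0 *: (\1%VF : 'End(fock R M)).
Proof. by rewrite -anticomm_qp_dag qp_dag_ph_conj. Qed.

(** The anticommutator is a multiple of the identity that kills the nonzero vector [Phi], so the
    multiple is zero. *)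
Lemma anticomm_qp_eq0 u v Phi : Phi != 0 ->
  qp_op u Phi = 0 -> qp_op v Phi = 0 -> anticomm (qp_op u) (qp_op v) = 0.
Proof.
move=> P0 uP vP; rewrite anticomm_qp.
set k := (_ *m _) 0 0.
have : k *: Phi = 0.
  have /lfunP/(_ Phi) := anticomm_qp u v.
  by rewrite add_lfunE !comp_lfunE uP vP !linear0 addr0 scale_lfunE id_lfunE.
by move=> /eqP; rewrite scaler_eq0 (negPf P0) orbF => /eqP->; rewrite scale0r.
Qed.

(* If [X k] does not kill a vacuum [Phi] of the other operators, then [X k Phi]
   is a common vacuum, since [X k] has square zero. *)
Lemma common_vacuum (I : eqType) (X : I -> 'End(fock R M)) (s : seq I) :
  (forall k l, k \in s -> l \in s -> anticomm (X k) (X l) = 0) ->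
  exists2 Phi, Phi != 0 & forall k, k \in s -> X k Phi = 0.
Proof.
elim: s => [|k s IH] anti.
  exists [ffun => 1] => //; apply/eqP => /ffunP/(_ set0).
  by rewrite !ffunE => /eqP; rewrite oner_eq0.
have [|Phi P0 sP] := IH; first by move=> a b sa sb; apply: anti; rewrite inE (sa,sb) orbT.
have [kP|kP] := eqVneq (X k Phi) 0.
  by exists Phi => // l; rewrite inE => /predU1P[->|/sP].
have antiE l : l \in k :: s -> X k (X l Phi) + X l (X k Phi) = 0.
  move=> ls; have /lfunP/(_ Phi) := anti k l (mem_head _ _) ls.
  by rewrite add_lfunE !comp_lfunE zero_lfunE.
exists (X k Phi) => // l; rewrite inE => /predU1P[->|ls].
  have /eqP := antiE k (mem_head _ _).
  by rewrite -mulr2n -scaler_nat scaler_eq0 pnatr_eq0 => /eqP.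
by have := antiE l; rewrite inE ls orbT (sP l ls) linear0 add0r; apply.
Qed.

Lemma bdg_lfunE (h : 'M[R[i]]_(M + M)) (C : R) Phi :
  bdg h C Phi =
  \sum_a \sum_b h a b *: nambu_dag R a (nambu R b Phi) + C%:C *: Phi.
Proof.
rewrite /bdg add_lfunE scale_lfunE id_lfunE sum_lfunE; congr (_ + _).
apply: eq_bigr => a _; rewrite sum_lfunE.
by apply: eq_bigr => b _; rewrite scale_lfunE comp_lfunE.
Qed.

(** Carries the rank-one terms of the matrix decomposition over to operators. *)
Lemma qp_dag_qp_op v Phi :
  qp_dag v (qp_op v Phi) =
  \sum_a \sum_b (v *m v^t*) a b *: nambu_dag R a (nambu R b Phi).
Proof.
rewrite qp_dagE; apply: eq_bigr => a _; rewrite qp_opE linear_sum scaler_sumr /=.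
apply: eq_bigr => b _; rewrite linearZ scalerA; congr (_ *: _).
by rewrite mxE big_ord1 !mxE.
Qed.

(** By the anticommutation relation for the unit vector [psi al], its partner contributes the
    identity minus the term of [psi al]. Subtracting it doubles the weight of that term and lowers
    the constant by [eps al]. *)
Lemma bdg_normal_form A (h : 'M[R[i]]_(M + M)) (C : R)
    (psi : 'I_A -> 'cV[R[i]]_(M + M)) (eps : 'I_A -> R) Phi :
  (forall al be, (psi al)^t* *m psi be = (al == be)%:R%:M) ->
  h = \sum_al (eps al)%:C *:
        (psi al *m (psi al)^t* - ph_conj (psi al) *m (ph_conj (psi al))^t*) ->
  bdg h C Phi = \sum_al (2 * eps al)%:C *: qp_dag (psi al) (qp_op (psi al) Phi)
    + (C - \sum_al eps al)%:C *: Phi.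
Proof.
move=> orth hE; rewrite bdg_lfunE hE.
transitivity (\sum_al (eps al)%:C *: (qp_dag (psi al) (qp_op (psi al) Phi)
    - qp_dag (ph_conj (psi al)) (qp_op (ph_conj (psi al)) Phi)) + C%:C *: Phi).
  congr (_ + _).
  under [RHS]eq_bigr do rewrite !qp_dag_qp_op -sumrB scaler_sumr.
  rewrite [RHS]exchange_big; apply: eq_bigr => a _ /=.
  under [RHS]eq_bigr do rewrite -sumrB scaler_sumr.
  rewrite [RHS]exchange_big; apply: eq_bigr => b _ /=.
  rewrite summxE scaler_suml; apply: eq_bigr => al _.
  rewrite -scalerBl scalerA; congr (_ *: _).
  by rewrite !mxE.
rewrite rmorphB rmorph_sum /= scalerBl scaler_suml [RHS]addrA [RHS]addrAC -sumrB.
congr (_ + _); apply: eq_bigr => al _.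
rewrite qp_dag_ph_conj qp_op_ph_conj.
have /lfunP/(_ Phi) := anticomm_qp_dag (psi al) (psi al).
rewrite add_lfunE !comp_lfunE scale_lfunE id_lfunE orth eqxx mxE scale1r.
move=> /(canRL (addrK _)) ->.
rewrite opprB addrA scalerBr -mulr2n; congr (_ - _).
by rewrite rmorphM /= rmorph_nat -scalerA scaler_nat scalerMnr.
Qed.

Lemma leigenvalueP (H : 'End(fock R M)) (e : R[i]) :
  reflect (exists2 Phi, Phi != 0 & H Phi = e *: Phi) (passmx.leigenvalue H e).
Proof.
have memE Phi : (Phi \in passmx.leigenspace H e) = (H Phi == e *: Phi).
  by rewrite memv_ker add_lfunE opp_lfunE scale_lfunE id_lfunE subr_eq0.
apply: (iffP idP) => [He|[Phi P0 HP]].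
  exists (vpick (passmx.leigenspace H e)); first by rewrite vpick0.
  by apply/eqP; rewrite -memE memv_pick.
by apply: contra P0 => /eqP H0; rewrite -memv0 -H0 memE HP.
Qed.

(** * Ground energy and ground space of an operator in normal form *)

Section GroundSpace.
Variables (A : nat) (H : 'End(fock R M)) (E : R).
Variables (psi : 'I_A -> 'cV[R[i]]_(M + M)) (w : 'I_A -> R).
Hypothesis w_gt0 : forall al, 0 < w al.
Hypothesis HE : forall Phi, H Phi =
  \sum_al (w al)%:C *: qp_dag (psi al) (qp_op (psi al) Phi) + E%:C *: Phi.

Lemma ground_energy Phi : inner Phi (H Phi) =
  \sum_al (w al)%:C * inner (qp_op (psi al) Phi) (qp_op (psi al) Phi)
    + E%:C * inner Phi Phi.
Proof.
rewrite HE innerDr innerZr inner_sumr; congr (_ + _).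
by apply: eq_bigr => al _; rewrite innerZr qp_adjoint.
Qed.

Lemma energy_term_ge0 al Phi :
  0 <= (w al)%:C * inner (qp_op (psi al) Phi) (qp_op (psi al) Phi).
Proof. by rewrite mulr_ge0 ?inner_ge0 // lecR ltW. Qed.

(** Pair the eigenvalue equation with the eigenvector: the quadratic terms are nonnegative and the
    squared norm is positive. In the order of [R[i]] the inequality also contains the reality of
    [e]. *)
Lemma eigenvalue_ge_ground e : passmx.leigenvalue H e -> E%:C <= e.
Proof.
case/leigenvalueP => Phi P0 HP.
rewrite -(ler_pM2r (inner_gt0 P0)) -(innerZr e) -HP ground_energy lerDr.
by apply: sumr_ge0 => al _; exact: energy_term_ge0.
Qed.

(** If the expectation of [H] equals [E] times the squared norm, the nonnegative terms sum to zero;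
    as the weights are positive, each [qp_op (psi al) Phi] has norm zero. *)
Lemma ground_spaceP Phi :
  H Phi = E%:C *: Phi <-> forall al, qp_op (psi al) Phi = 0.
Proof.
split=> [HP al|q0]; last first.
  by rewrite HE big1 ?add0r // => al _; rewrite q0 linear0 scaler0.
have /eqP := ground_energy Phi.
rewrite HP innerZr -subr_eq0 opprD addrCA subrr addr0 oppr_eq0.
rewrite psumr_eq0 => [/allP/(_ al (mem_index_enum _))|be _]; last first.
  exact: energy_term_ge0.
rewrite /= mulf_eq0 => /orP[|/eqP/inner_eq0 //].
by rewrite -[0]/(0%:C) (inj_eq (@complexI R)) gt_eqF.
Qed.

(** A nonzero common vacuum attains the lower bound [E]. *)
Lemma smallest_eigenvalue_ground Phi : Phi != 0 ->
  (forall al, qp_op (psi al) Phi = 0) -> smallest_eigenvalue H E.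
Proof.
move=> P0 /ground_spaceP HP; split; last exact: eigenvalue_ge_ground.
by apply/leigenvalueP; exists Phi.
Qed.

Lemma smallest_eigenvalue_uniq E1 E2 :
  smallest_eigenvalue H E1 -> smallest_eigenvalue H E2 -> E1 = E2.
Proof.
move=> [H1 m1] [H2 m2]; apply: le_anti.
by move: (m1 _ H2) (m2 _ H1); rewrite !lecR => -> ->.
Qed.

End GroundSpace.
End FockOperators.

(** * Frustration-freeness and the anticommutation of quasiparticles *)

Theorem mainTheorem4 (R : realType) (M : nat) (Lambda : finType)
    (cell : 'I_M -> Lambda) (dist : Lambda -> Lambda -> R) (range : R)
    (h : Lambda -> 'M[R[i]]_(M + M)) (C : Lambda -> R)
    (A : Lambda -> nat) (psi : forall r : Lambda, 'I_(A r) -> 'cV[R[i]]_(M + M))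
    (hdist : is_metric dist)
    (hloc : forall r : Lambda, supported_near cell dist range r (h r))
    (hherm : forall r : Lambda, h r \is hermsymmx)
    (hPH : forall r : Lambda, particle_hole (h r))
    (hpsi : forall r : Lambda, positive_eigenframe (h r) (psi r)) :
  frustration_free (fun r : Lambda => bdg (h r) (C r)) <->
  (forall (r r' : Lambda) (al : 'I_(A r)) (al' : 'I_(A r')),
     anticomm (qp_op (psi r al)) (qp_op (psi r' al')) = 0).
Proof.
have normal r : exists E, exists w : 'I_(A r) -> R,
   [/\ forall al, 0 < w al,
       forall Phi, bdg (h r) (C r) Phi =
         \sum_al (w al)%:C *: qp_dag (psi r al) (qp_op (psi r al) Phi)
           + E%:C *: Phi
     & forall al be, anticomm (qp_op (psi r al)) (qp_op (psi r be)) = 0].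
  have [eps [orth eig rk]] := hpsi r.
  have [orth0 hE] := bdg_matrix_decomposition (hherm r) (hPH r) orth eig rk.
  exists (C r - \sum_al eps al), (fun al => 2 * eps al); split=> [al|Phi|al be].
  - by rewrite mulr_gt0 // (eig al).1.
  - exact: bdg_normal_form.
  - by rewrite anticomm_qp orth0 mxE scale0r.
split=> [[Phi [P0 ff]] r r' al al'|anti].
  have kill s be : qp_op (psi s be) Phi = 0.
    have [E [w [w0 HE anti]]] := normal s.
    (* Within one term the operators anticommute, since [psi] is orthogonal to all the partners.
       Their vacuum [Xi] shows that [E] is the smallest eigenvalue, hence the energy of [Phi] for
       this term. *)
    have [Xi X0 qX] := common_vacuum (s := enum 'I_(A s)) (fun k l _ _ => anti k l).
    have sE : smallest_eigenvalue (bdg (h s) (C s)) E.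
      by apply: (smallest_eigenvalue_ground w0 HE X0) => k; rewrite qX ?mem_enum.
    have [E' [sE' HP]] := ff s.
    rewrite (smallest_eigenvalue_uniq sE' sE) in HP.
    exact: (ground_spaceP w0 HE Phi).1 HP be.
  exact: anticomm_qp_eq0 P0 (kill r al) (kill r' al').
(* The operators of all terms form one finite family, indexed by dependent pairs because the number
   of them varies with [r]. *)
pose X (k : {r : Lambda & 'I_(A r)}) := qp_op (psi (tag k) (tagged k)).
have [Phi P0 qP] := common_vacuum (X := X) (s := enum {: {r : Lambda & 'I_(A r)}})
  (fun k l _ _ => anti _ _ _ _).
have qP' r al : qp_op (psi r al) Phi = 0.
  by apply: (qP (Tagged (fun r => 'I_(A r)) al)); rewrite mem_enum.
exists Phi; split=> // r; have [E [w [w0 HE _]]] := normal r.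
exists E; split; last by apply/(ground_spaceP w0 HE) => al; exact: qP'.
by apply: (smallest_eigenvalue_ground w0 HE P0) => al; exact: qP'.
Qed.
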